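(* Let $m\in\mathbb{N}$ and $p_m:=\frac{2m}{2m-1}$. Let $K\in L_0(\Omega\times\Omega')$ be a generalized Mercer kernel, $K(x,y)=\sum_{n\in\mathbb{N}}\phi_n(x)\phi_n'(y)$ (pointwise convergent), whose expansion sets $\{\phi_n\}_{n\in\mathbb{N}}\subseteq L_0(\Omega)$ and $\{\phi_n'\}_{n\in\mathbb{N}}\subseteq L_0(\Omega')$ are linearly independent and satisfy $\sum_n|\phi_n(x)|<\infty$ for all $x\in\Omega$ and $\sum_n|\phi_n'(y)|<\infty$ for all $y\in\Omega'$, and such that the right-sided kernel set $\{K(x,\cdot):x\in\Omega\}$ is linearly independent. Let $x_1,\dots,x_N\in\Omega$ be any pairwise distinct points and $y_1,\dots,y_N\in\mathbb{R}$ any values. Let $R:[0,\infty)\to[0,\infty)$ be convex and strictly increasing, and let $L:\Omega\times\mathbb{R}\times\mathbb{R}\to[0,\infty)$ be such that $t\mapsto L(x,y,t)$ is convex for each fixed $x\in\Omega$, $y\in\mathbb{R}$. Define $$\mathcal{T}_{p_m}(f):=\frac1N\sum_{k=1}^NL(x_k,y_k,f(x_k))+R\big(\|f\|_{\mathcal{B}_K^{p_m}(\Omega)}\big),\qquad f\in\mathcal{B}_K^{p_m}(\Omega).$$ Then the unique global solution $s_{p_m}$ of the support vector machine $\min_{f\in\mathcal{B}_K^{p_m}(\Omega)}\mathcal{T}_{p_m}(f)$ has the finite dimensional representation $$s_{p_m}(x)=\sum_{k_1,\dots,k_{2m-1}=1}^N\alpha_{k_1,\dots,k_{2m-1}}K^{*(2m-1)}(x,x_{k_1},\dots,x_{k_{2m-1}}),\qquad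 x\in\Omega,$$ and its norm can be written as $$\|s_{p_m}\|_{\mathcal{B}_K^{p_m}(\Omega)}=\left(\sum_{k_0,\dots,k_{2m-1}=1}^N\beta_{k_0,\dots,k_{2m-1}}K^{*(2m-1)}(x_{k_0},\dots,x_{k_{2m-1}})\right)^{1-\frac1{2m}},$$ where $$K^{*(2m-1)}(x,z_1,\dots,z_{2m-1}):=\sum_{n\in\mathbb{N}}\phi_n(x)\prod_{j=1}^{2m-1}\phi_n(z_j),\qquad x,z_1,\dots,z_{2m-1}\in\Omega,$$ and the coefficients $\alpha_{k_1,\dots,k_{2m-1}}:=\prod_{j=1}^{2m-1}c_{k_j}$ and $\beta_{k_0,k_1,\dots,k_{2m-1}}:=c_{k_0}\prod_{j=1}^{2m-1}c_{k_j}$ are computed from some parameters $c_1,\dots,c_N\in\mathbb{R}$.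
   Context: $\Omega,\Omega'$ are locally compact Hausdorff spaces equipped with regular Borel measures. $L_0(X)$ denotes the set of real-valued measurable functions on $X$ (genuine functions). For $1<p<\infty$ the space $\mathcal{B}_K^p(\Omega)$ is $\{f=\sum_{n}a_n\phi_n:(a_n)\in\ell_p\}$ with norm $\|f\|_{\mathcal{B}_K^p(\Omega)}=(\sum_n|a_n|^p)^{1/p}$ (series converge pointwise; the norm is taken to be well defined in terms of the coefficients). A countable family of functions is linearly independent if no nontrivial finite linear combination of distinct members vanishes; linear independence of $\{K(x,\cdot):x\in\Omega\}$ means that for any pairwise distinct $z_1,\dots,z_M\in\Omega$, $\sum_kc_kK(z_k,\cdot)=0$ implies all $c_k=0$.
   Formalization: Uniqueness of the solution is claimed only for strictly convex R, since it fails in general (e.g. hinge loss, R(r)=r, N=1); instead a global solution is shown to exist and every global solution is shown to have the stated representation and norm formula. *)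

(* Defs.v *)
From HB Require Import structures.
From mathcomp Require Import all_boot all_order all_algebra.
From mathcomp Require Import all_classical all_reals all_analysis.

Set Implicit Arguments.
Unset Strict Implicit.
Unset Printing Implicit Defensive.

Import Order.TTheory GRing.Theory Num.Theory.
Import numFieldNormedType.Exports.

Local Open Scope classical_set_scope.
Local Open Scope ring_scope.

(* [T] with its Borel sigma-algebra.  The library attaches generated
   sigma-algebras to pointed types only, i.e. to nonempty spaces. *)
Notation borelType T := (g_sigma_algebraType (@open T)).

Definition regular_borel_measure (R : realType) (T : ptopologicalType)
    (mu : {measure set (borelType T) -> \bar R}) : Prop :=
  [/\ forall A : set T, compact A -> (mu A < +oo)%E,
      forall A : set (borelType T), measurable A ->
        mu A = ereal_inf [set mu U | U in [set U : set T | open U /\ A `<=` U]]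
    & forall U : set T, open U ->
        mu U = ereal_sup [set mu A | A in [set A : set T | compact A /\ A `<=` U]]].

(* Linear independence of the indexed family [F]: distinct members means
   distinct indices. *)
Definition linearly_independent (R : realType) (I : choiceType) (T : Type)
    (F : I -> T -> R) : Prop :=
  forall (s : seq I) (c : I -> R), uniq s ->
    (forall t : T, \sum_(i <- s) c i * F i t = 0) ->
    forall i, i \in s -> c i = 0.

(* On [Omega * Omega'], measurability refers to the product of the two Borel
   sigma-algebras. *)
Definition generalized_mercer_kernel (R : realType) (Omega Omega' : ptopologicalType)
    (K : Omega * Omega' -> R)
    (phi : nat -> Omega -> R) (phi' : nat -> Omega' -> R) : Prop :=
  [/\ measurable_fun [set: borelType Omega * borelType Omega']
        (K : borelType Omega * borelType Omega' -> R),
      forall n, measurable_fun [set: borelType Omega] (phi n : borelType Omega -> R),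
      forall n, measurable_fun [set: borelType Omega'] (phi' n : borelType Omega' -> R)
    & forall x y, series (fun n => phi n x * phi' n y) @ \oo --> K (x, y)].

Section BK_space.
Context {R : realType} {T : Type}.
Implicit Types (phi : nat -> T -> R) (p : R) (a : nat -> R) (f : T -> R).

Definition lp_norm p a : \bar R := Lnorm counting p%:E (EFin \o a).

Definition lp p : set (nat -> R) := [set a | (lp_norm p a < +oo)%E].

Definition expansion phi a f : Prop :=
  forall x, series (fun n => a n * phi n x) @ \oo --> f x.

Definition BK phi p : set (T -> R) :=
  [set f | exists2 a, lp p a & expansion phi a f].

Definition BK_norm_well_defined phi p : Prop :=
  forall f a b, lp p a -> lp p b -> expansion phi a f -> expansion phi b f ->
    lp_norm p a = lp_norm p b.

(* [get] selects some coefficient sequence of [f]; the value does not depend on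
   the selection when [BK_norm_well_defined phi p] holds. *)
Definition BK_norm phi p f : R :=
  fine (lp_norm p (get [set a | lp p a /\ expansion phi a f])).

Definition Kstar phi (k : nat) (x : T) (z : 'I_k -> T) : R :=
  limn (series (fun n => phi n x * \prod_(j < k) phi n (z j))).

Definition svm_risk phi p (N : nat) (x : 'I_N -> T) (y : 'I_N -> R)
    (L : T -> R -> R -> R) (Rg : R -> R) f : R :=
  N%:R^-1 * (\sum_(k < N) L (x k) (y k) (f (x k))) + Rg (BK_norm phi p f).

Definition svm_solution phi p (N : nat) (x : 'I_N -> T) (y : 'I_N -> R)
    (L : T -> R -> R -> R) (Rg : R -> R) f : Prop :=
  BK phi p f /\
  forall g, BK phi p g ->
    svm_risk phi p x y L Rg f <= svm_risk phi p x y L Rg g.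

End BK_space.

(* A convex strictly increasing regularizer does not make the minimizer unique:
   with [N = 1], [Rg r = r], [L u v t = Num.max 0 (1 - t)] and
   [phi n u = (n == u)%:R] on the discrete space [nat], every [t * phi 0], with
   [0 <= t <= 1], is a minimizer for [x_1 = 0].  Uniqueness is
   therefore asserted for strictly convex regularizers. *)
Definition strictly_convex_on_nonneg (R : realType) (g : R -> R) : Prop :=
  forall r s t : R, 0 <= r -> 0 <= s -> r != s -> 0 < t -> t < 1 ->
    g (t * r + (1 - t) * s) < t * g r + (1 - t) * g s.

(* Main.v *)
Require Import Defs.
From HB Require Import structures.
From mathcomp Require Import all_boot all_order all_algebra.
From mathcomp Require Import all_classical all_reals all_analysis.
From mathcomp Require Import ring lra.

Set Implicit Arguments.
Unset Strict Implicit.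
Unset Printing Implicit Defensive.

Import Order.TTheory GRing.Theory Num.Theory.
Import numFieldNormedType.Exports.

Local Open Scope classical_set_scope.
Local Open Scope ring_scope.

(* Write q = 2m and r = q - 1.  Every a in l_p is a_n = b_n^r with b in l_q and
   |a|_p^p = sum_n b_n^q.  Let w(c)_n = sum_k c_k phi_n(x_k), with c in R^N.  For
   fixed b, the convex polynomial sum_n w(c)_n^q - q sum_n b_n^r w(c)_n in c is
   coercive because the sequences (phi_n(x_k))_n are free, and at a minimizer c the
   coefficients w(c)^r and b^r give the same values at all the points x_k.  Then
   sum w^q = sum b^r w, so Young's inequality q b^r w <= r b^q + w^q yields
   sum w^q <= sum b^q, with equality only if b = w.  Hence each f in the space is
   interpolated at the x_k by some function with coefficients w(c)^r, of strictly
   smaller norm unless it is f; expanding the power r gives the kernels K^*.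
   Existence thereby reduces to minimizing a continuous coercive function on R^N. *)

(** * Young's inequality for natural powers, with its equality case *)

Section young.
Context {R : realFieldType}.
Implicit Types (b w : R) (r : nat).

(** Induction on r: the defect at r + 1 is (r + 1) b^r (b - w)^2 plus w times the defect at r. *)
Lemma young_ge0 r b w : 0 <= b -> 0 <= w ->
  0 <= r%:R * b ^+ r.+1 + w ^+ r.+1 - r.+1%:R * (b ^+ r * w).
Proof.
move=> b0 w0; elim: r => [|r IH]; first by rewrite !expr1 expr0; lra.
have -> : r.+1%:R * b ^+ r.+2 + w ^+ r.+2 - r.+2%:R * (b ^+ r.+1 * w) =
    r.+1%:R * b ^+ r * (b - w) ^+ 2 +
    w * (r%:R * b ^+ r.+1 + w ^+ r.+1 - r.+1%:R * (b ^+ r * w)).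
  by rewrite -!natr1 !exprS; ring.
by rewrite addr_ge0// mulr_ge0// ?sqr_ge0// mulr_ge0// exprn_ge0.
Qed.

(** Both summands of the recursion behind [young_ge0] must vanish. The square term gives b = w or b
    = 0, and for b = 0 the hypothesis reduces to a vanishing power of w. *)
Lemma young_ge0_eq r b w : (0 < r)%N -> 0 <= b -> 0 <= w ->
  r%:R * b ^+ r.+1 + w ^+ r.+1 = r.+1%:R * (b ^+ r * w) -> b = w.
Proof.
case: r => // r _ b0 w0 e.
have Y := young_ge0 r b0 w0.
have S : 0 <= r.+1%:R * b ^+ r * (b - w) ^+ 2.
  by rewrite mulr_ge0// ?sqr_ge0// mulr_ge0// exprn_ge0.
have : r.+1%:R * b ^+ r * (b - w) ^+ 2 +
    w * (r%:R * b ^+ r.+1 + w ^+ r.+1 - r.+1%:R * (b ^+ r * w)) = 0.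
  transitivity (r.+1%:R * b ^+ r.+2 + w ^+ r.+2 - r.+2%:R * (b ^+ r.+1 * w)).
    by rewrite -!natr1 !exprS; ring.
  by rewrite e subrr.
move/eqP; rewrite paddr_eq0// ?mulr_ge0// => /andP[+ _].
rewrite mulf_eq0 (@expf_eq0 _ (b - w)) subr_eq0 mulf_eq0 pnatr_eq0/=.
move=> /orP[+|/eqP//].
rewrite expf_eq0 => /andP[_ /eqP bz].
move: e; rewrite bz !expr0n/= mulr0 mul0r mulr0 add0r => /eqP.
by rewrite expf_eq0 => /eqP ->.
Qed.

Lemma norm_exprS_odd r b : odd r -> `|b| ^+ r.+1 = b ^+ r.+1.
Proof. by move=> ro; rewrite -normrX ger0_norm// exprn_even_ge0//= ro. Qed.

(** As r + 1 is even, passing to absolute values keeps the right-hand side and can only increase the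
    left-hand one. *)
Lemma young_odd r b w : odd r ->
  r.+1%:R * (b ^+ r * w) <= r%:R * b ^+ r.+1 + w ^+ r.+1.
Proof.
move=> ro; have Y := young_ge0 r (normr_ge0 b) (normr_ge0 w).
rewrite !norm_exprS_odd// subr_ge0 in Y; apply: le_trans Y.
by rewrite ler_wpM2l// -normrX -normrM ler_norm.
Qed.

(** Equality must also hold for the absolute values, so |b| = |w|. If w = - b, then b^r w is both
    b^(r+1) and its opposite, whence b = 0. *)
Lemma young_odd_eq r b w : odd r ->
  r%:R * b ^+ r.+1 + w ^+ r.+1 = r.+1%:R * (b ^+ r * w) -> b = w.
Proof.
move=> ro e.
have Y := young_ge0 r (normr_ge0 b) (normr_ge0 w).
rewrite !norm_exprS_odd// subr_ge0 e ler_pM2l ?ltr0n// in Y.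
have e' : `|b| ^+ r * `|w| = b ^+ r * w.
  by apply/eqP; rewrite eq_le Y -normrX -normrM ler_norm.
have bw : `|b| = `|w|.
  apply: (@young_ge0_eq r) => //; first exact: odd_gt0.
  by rewrite !norm_exprS_odd// e' e.
have /orP[/eqP->//|/eqP bN] : (b == w) || (b == - w).
  by rewrite -eqr_norm2 bw.
have {bN} wb : w = - b by rewrite bN opprK.
move: e'; rewrite -bw -exprSr norm_exprS_odd// wb mulrN -exprSr => e'.
have : b ^+ r.+1 = 0 by lra.
by move/eqP; rewrite expf_eq0/= => /eqP->; rewrite oppr0.
Qed.

End young.

(** * Convergent real series *)

Section real_series.
Context {R : realType}.
Implicit Types (u v : nat -> R) (l : R).

Lemma cvg_series_unique u l l' :
  series u @ \oo --> l -> series u @ \oo --> l' -> l = l'.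
Proof. exact: cvg_unique. Qed.

Lemma eq_cvg_series u v l : u =1 v -> series u @ \oo --> l ->
  series v @ \oo --> l.
Proof. by move=> /funext->. Qed.

Lemma cvg_seriesD u v l l' : series u @ \oo --> l -> series v @ \oo --> l' ->
  series (fun n => u n + v n) @ \oo --> l + l'.
Proof.
move=> ul vl; rewrite (_ : series _ = series u + series v); first exact: cvgD.
by rewrite -seriesD.
Qed.

Lemma cvg_seriesZ k u l : series u @ \oo --> l ->
  series (fun n => k * u n) @ \oo --> k * l.
Proof.
move=> ul; rewrite (_ : series _ = k *: series u); first exact: cvgZr.
by rewrite -seriesZ.
Qed.

Lemma cvg_seriesB u v l l' : series u @ \oo --> l -> series v @ \oo --> l' ->
  series (fun n => u n - v n) @ \oo --> l - l'.
Proof.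
move=> ul vl; have := cvg_seriesD ul (cvg_seriesZ (k := -1) vl).
by rewrite mulN1r; apply: eq_cvg_series => n; rewrite mulN1r.
Qed.

Lemma cvg_series_sum (I : Type) (s : seq I) (F : I -> nat -> R) (l : I -> R) :
  (forall i, series (F i) @ \oo --> l i) ->
  series (fun n => \sum_(i <- s) F i n) @ \oo --> \sum_(i <- s) l i.
Proof.
move=> Fl; elim: s => [|i s IH].
  rewrite big_nil (_ : series _ = cst 0); first exact: cvg_cst.
  by apply/funext => n; rewrite /series/= big1// => k _; rewrite big_nil.
rewrite big_cons; apply: eq_cvg_series (cvg_seriesD (Fl i) IH) => n.
by rewrite big_cons.
Qed.

Lemma cvg_series_le u v l l' : (forall n, u n <= v n) ->
  series u @ \oo --> l -> series v @ \oo --> l' -> l <= l'.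
Proof.
move=> uv ul vl'; rewrite -(cvg_lim _ ul)// -(cvg_lim _ vl')//.
by apply: lim_series_le => //; [apply: cvgP ul | apply: cvgP vl'].
Qed.

Lemma cvg_series_ge0 u l : (forall n, 0 <= u n) -> series u @ \oo --> l ->
  forall n, u n <= l.
Proof.
move=> u0 ul n; rewrite -(cvg_lim _ ul)//.
apply: le_trans (nondecreasing_cvgn_le _ _ n.+1); last first.
- exact: cvgP ul.
- exact: nondecreasing_series.
by rewrite seriesSr lerDr sumr_ge0.
Qed.

Lemma cvg_series_exprS_ge0 r u l : odd r ->
  series (fun n => u n ^+ r.+1) @ \oo --> l -> 0 <= l.
Proof.
move=> ro ul; have u0 n : 0 <= u n ^+ r.+1 by rewrite exprn_even_ge0//= ro.
exact: le_trans (u0 0%N) (cvg_series_ge0 u0 ul 0%N).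
Qed.

Lemma cvg_series_eq0 u : (forall n, 0 <= u n) -> series u @ \oo --> (0 : R) ->
  forall n, u n = 0.
Proof.
by move=> u0 ul n; apply/eqP; rewrite eq_le u0 (cvg_series_ge0 u0 ul).
Qed.

Lemma cvgn_series_norm_le u v : (forall n, `|u n| <= v n) ->
  cvgn (series v) -> cvgn (series u).
Proof.
move=> uv cv; apply: normed_cvg; apply: series_le_cvg cv => // n.
- exact: normr_ge0.
- exact: le_trans (normr_ge0 _) (uv n).
Qed.

Lemma cvgn_series_norm_bounded u : cvgn (series (fun n => `|u n|)) ->
  exists2 B, 0 <= B & forall n, `|u n| <= B.
Proof.
move=> cu.
have uB : forall n, `|u n| <= limn (series (fun n => `|u n|)).
  exact: cvg_series_ge0 cu.
by exists (limn (series (fun n => `|u n|))) => //; exact: le_trans _ (uB 0%N).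
Qed.

Lemma cvgn_seriesM_bounded u v B : cvgn (series (fun n => `|u n|)) ->
  (forall n, `|v n| <= B) -> cvgn (series (fun n => u n * v n)).
Proof.
move=> cu vB; apply: (@cvgn_series_norm_le _ (fun n => B * `|u n|)) => [n|].
  by rewrite normrM mulrC ler_wpM2r.
exact: cvgP (cvg_seriesZ (k := B) cu).
Qed.

(** Young's inequality is summed termwise. In case of equality the nonnegative defects have sum 0,
    so each of them vanishes. *)
Lemma young_series r b w (Eb Ew X : R) : odd r ->
  series (fun n => b n ^+ r.+1) @ \oo --> Eb ->
  series (fun n => w n ^+ r.+1) @ \oo --> Ew ->
  series (fun n => b n ^+ r * w n) @ \oo --> X ->
  r.+1%:R * X <= r%:R * Eb + Ew /\
  (r.+1%:R * X = r%:R * Eb + Ew -> b = w).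
Proof.
move=> ro cb cw cX.
have cl := cvg_seriesZ (k := r.+1%:R) cX.
have cr := cvg_seriesD (cvg_seriesZ (k := r%:R) cb) cw.
split; first by apply: cvg_series_le cl cr => n; exact: young_odd.
move=> e; have := cvg_seriesB cr cl.
rewrite e subrr => c0; apply/funext => n; apply: (young_odd_eq ro).
apply/eqP; rewrite -subr_eq0; apply/eqP; move: n; apply: cvg_series_eq0 c0.
by move=> n; rewrite subr_ge0 young_odd.
Qed.

(** This takes the place of Hölder's inequality: Young's inequality at |b n| and |w n| provides a
    convergent majorant. *)
Lemma cvgn_series_young r (b w : nat -> R) : odd r ->
  cvgn (series (fun n => b n ^+ r.+1)) -> cvgn (series (fun n => w n ^+ r.+1)) ->
  cvgn (series (fun n => b n ^+ r * w n)).
Proof.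
move=> ro cb cw.
apply: (@cvgn_series_norm_le _ (fun n => r%:R * b n ^+ r.+1 + w n ^+ r.+1)).
  move=> n; apply: (@le_trans _ _ (r.+1%:R * `|b n ^+ r * w n|)).
    by rewrite ler_peMl// ler1n.
  have := young_odd `|b n| `|w n| ro.
  by rewrite !norm_exprS_odd// -normrX -normrM.
exact: cvgP (cvg_seriesD (cvg_seriesZ cb) cw).
Qed.

Lemma cvgn_seriesX r (v : nat -> R) : cvgn (series (fun n => `|v n|)) ->
  cvgn (series (fun n => v n ^+ r.+1)).
Proof.
move=> cv; have [B B0 vB] := cvgn_series_norm_bounded cv.
rewrite (_ : (fun n => _) = (fun n => v n * v n ^+ r)).
  apply: (cvgn_seriesM_bounded (B := B ^+ r)) cv _ => n.
  by rewrite normrX lerXn2r.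
by apply/funext => n; rewrite exprS.
Qed.

End real_series.

(** * Continuity of finite sums and products *)

Section continuous_bigop.
Context {R : realType}.

Lemma continuous_sum_fun (T : topologicalType) (I : Type) (s : seq I)
  (F : I -> T -> R) : (forall i, continuous (F i)) ->
  continuous (fun x => \sum_(i <- s) F i x).
Proof.
by move=> Fc x; apply: cvg_big => [|i _]; [exact: add_continuous|exact: Fc].
Qed.

Lemma continuous_prod_fun (T : topologicalType) (I : Type) (s : seq I)
  (F : I -> T -> R) : (forall i, continuous (F i)) ->
  continuous (fun x => \prod_(i <- s) F i x).
Proof.
by move=> Fc x; apply: cvg_big => [|i _]; [exact: mul_continuous|exact: Fc].
Qed.

End continuous_bigop.

(** * Minimization of coercive functions on R^N *)

Section row_vectors.
Context {R : realType} {N : nat}.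
Implicit Types (c : 'rV[R]_N).

(** The minimum over the compact ball of radius B is global, since the ball contains 0 and f exceeds
    f 0 outside it. *)
Lemma coercive_has_min (f : 'rV[R]_N -> R) (B : R) : continuous f ->
  (forall c, f c <= f 0 -> `|c| <= B) -> exists c, forall c', f c <= f c'.
Proof.
move=> fc fB; pose A := [set c : 'rV[R]_N | `|c| <= B].
have A0 : A 0 by exact: fB.
have cA : compact A.
  apply: bounded_closed_compact.
    exists B; split; first exact: num_real.
    by move=> M /ltW BM c /= /le_trans; exact.
  rewrite (_ : A = Num.norm @^-1` [set t : R | t <= B])//.
  apply: closed_comp; last exact: closed_le.
  by move=> c _; exact: norm_continuous.
have [|c cAc cmin] := EVT_min_rV (ex_intro _ _ A0) cA (f := f).
  exact: continuous_subspaceT.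
exists c => c'; have [/fB c'A|/ltW] := leP (f c') (f 0).
  by apply: cmin; rewrite inE.
by apply: le_trans; apply: cmin; rewrite inE.
Qed.

End row_vectors.

(** * Combinations of summable sequences and their energy polynomial *)

Section combinations.
Context {R : realType} {N : nat} (v : 'I_N -> nat -> R) (r : nat).
Hypothesis summable_v : forall k, cvgn (series (fun n => `|v k n|)).
Implicit Types (c : 'rV[R]_N).

Definition comb c n : R := \sum_k c 0 k * v k n.

(** For u n = phi_n(t) and v k n = phi_n(x_k) this is convertible to [Kstar] at t and the points
    x_(k j). *)
Definition mixed_moment (u : nat -> R) (k : {ffun 'I_r -> 'I_N}) : R :=
  limn (series (fun n => u n * \prod_(j < r) v (k j) n)).

(** This is the sum over n of w(c)_n^r u_n, given in expanded form: it is then visibly a polynomial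
    in c, and its coefficients are kernel values. *)
Definition comb_moment (u : nat -> R) c : R :=
  \sum_(k : {ffun 'I_r -> 'I_N}) (\prod_(j < r) c 0 (k j)) * mixed_moment u k.

(** The sum over n of w(c)_n^(r+1), with one factor w(c) split off to match the beta coefficients of
    the norm formula. *)
Definition energy c : R := \sum_k c 0 k * comb_moment (v k) c.

(** The power w(c)_n^r is distributed over all maps from ['I_r] to ['I_N]; each resulting series
    converges because u is summable and every v k is bounded. *)
Lemma cvg_comb_moment (u : nat -> R) c : cvgn (series (fun n => `|u n|)) ->
  series (fun n => comb c n ^+ r * u n) @ \oo --> comb_moment u c.
Proof.
move=> cu.
have /choice[B vB] : forall k, exists B, forall n, `|v k n| <= B.
  by move=> k; have [B _ ?] := cvgn_series_norm_bounded (@summable_v k); exists B.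
have cM (k : {ffun 'I_r -> 'I_N}) :
    series (fun n => (\prod_(j < r) c 0 (k j)) *
                     (u n * \prod_(j < r) v (k j) n)) @ \oo -->
    (\prod_(j < r) c 0 (k j)) * mixed_moment u k.
  apply: cvg_seriesZ.
  apply: (cvgn_seriesM_bounded (B := \prod_(j < r) B (k j))) cu _.
  by move=> n; rewrite normr_prod; apply: ler_prod => j _; rewrite normr_ge0/=.
apply: eq_cvg_series (cvg_series_sum cM) => n.
rewrite -[X in X ^+ r * _]/(comb c n) -[in RHS](card_ord r) -prodr_const.
rewrite bigA_distr_bigA big_distrl/=; apply: eq_bigr => k _.
by rewrite big_split/= -mulrA [u n * _]mulrC.
Qed.

Lemma comb_moment_continuous u : continuous (comb_moment u).
Proof.
apply: continuous_sum_fun => k c.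
apply: continuousM; last exact: cst_continuous.
apply: (continuous_prod_fun (F := fun j (c : 'rV[R]_N) => c 0 (k j))) => j.
exact: coord_continuous.
Qed.

Lemma energy_continuous : continuous energy.
Proof.
apply: continuous_sum_fun => k c.
apply: continuousM; first exact: coord_continuous.
exact: comb_moment_continuous.
Qed.

Lemma cvg_energy c : series (fun n => comb c n ^+ r.+1) @ \oo --> energy c.
Proof.
have H k : series (fun n => c 0 k * (comb c n ^+ r * v k n)) @ \oo -->
    c 0 k * comb_moment (v k) c.
  by apply: cvg_seriesZ; exact: cvg_comb_moment.
apply: eq_cvg_series (cvg_series_sum H) => n.
rewrite exprSr [X in _ * X]/comb big_distrr/=.
by apply: eq_bigr => k _; rewrite mulrCA.
Qed.

Lemma combZ t c n : comb (t *: c) n = t * comb c n.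
Proof. by rewrite /comb big_distrr/=; apply: eq_bigr => k _; rewrite mxE mulrA. Qed.

Lemma combD c c' n : comb (c + c') n = comb c n + comb c' n.
Proof. by rewrite /comb -big_split/=; apply: eq_bigr => k _; rewrite mxE mulrDl. Qed.

Lemma comb_delta k n : comb (delta_mx 0 k) n = v k n.
Proof.
rewrite /comb (bigD1 k)//= big1 ?addr0 => [|j jk]; rewrite mxE eqxx/=.
  by rewrite eqxx mul1r.
by rewrite (negbTE jk) mul0r.
Qed.

Lemma energyZ t c : energy (t *: c) = t ^+ r.+1 * energy c.
Proof.
apply: (cvg_series_unique (@cvg_energy (t *: c))).
by apply: eq_cvg_series (cvg_seriesZ (@cvg_energy c)) => n; rewrite combZ exprMn.
Qed.

Hypothesis r_odd : odd r.

Lemma energy_ge0 c : 0 <= energy c.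
Proof. exact: (cvg_series_exprS_ge0 r_odd (@cvg_energy c)). Qed.

Hypothesis free_v : forall c, (forall n, comb c n = 0) -> c = 0.

Lemma energy_gt0 c : c != 0 -> 0 < energy c.
Proof.
move=> c0; rewrite lt_neqAle energy_ge0 andbT.
have w0 n : 0 <= comb c n ^+ r.+1 by rewrite exprn_even_ge0//= r_odd.
apply: contra_neqN c0 => /eqP e0; apply: free_v => n.
have := @cvg_energy c; rewrite -e0 => /(cvg_series_eq0 w0)/(_ n).
by move/eqP; rewrite expf_eq0/= => /eqP.
Qed.

(** The energy is homogeneous of degree r + 1 and has a positive minimum on the compact unit
    sphere. *)
Lemma energy_coercive M : exists B, forall c, energy c <= M -> `|c| <= B.
Proof.
pose S := [set c : 'rV[R]_N | `|c| = 1].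
(* The sphere is empty when N = 0; the zero vector is then the only one. *)
have [S0|S0] := pselect (S !=set0); last first.
  exists 0 => c _; have [->|c0] := eqVneq c 0; first by rewrite normr0.
  exfalso; apply: S0; exists (`|c|^-1 *: c).
  by rewrite /S/= normrZ normfV normr_id mulVf// normr_eq0.
have cS : compact S.
  apply: bounded_closed_compact.
    by exists 1; split; [exact: num_real | move=> M1 /ltW BM c /= ->].
  rewrite (_ : S = Num.norm @^-1` [set 1 : R])//.
  apply: closed_comp; last exact: closed_eq.
  by move=> c _; exact: norm_continuous.
have [|c1 c1S cmin] := EVT_min_rV S0 cS (f := energy).
  by apply: continuous_subspaceT; exact: energy_continuous.
rewrite inE in c1S.
have d0 : 0 < energy c1.
  by apply: energy_gt0; rewrite -normr_eq0 c1S oner_eq0.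
(* For |c| > 1 we have |c|^(r+1) >= |c|, so homogeneity makes the energy of c at least |c| times
   that of c1. *)
exists (Num.max 1 (M / energy c1)) => c cM.
have [|c_gt1] := leP `|c| 1; first by rewrite le_max => ->.
have c_gt0 : 0 < `|c| by exact: lt_trans c_gt1.
rewrite le_max; apply/orP; right; rewrite ler_pdivlMr// (le_trans _ cM)//.
have -> : c = `|c| *: (`|c|^-1 *: c).
  by rewrite scalerA mulfV ?scale1r// gt_eqF.
rewrite energyZ normrZ normrZ normfV normr_id mulVf ?gt_eqF// mulr1.
apply: ler_pM => //; [exact: ltW | by rewrite exprS ler_peMr// exprn_ege1// ltW |].
by apply: cmin; rewrite inE /S/= normrZ normfV normr_id mulVf// gt_eqF.
Qed.

(** The vector c is a minimizer of [G] below: its first-order conditions are the moment identities,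
    and Young's inequality then compares the energies. *)
Lemma comb_moment_match (b : nat -> R) (Eb : R) :
  series (fun n => b n ^+ r.+1) @ \oo --> Eb ->
  exists c, [/\ forall k, series (fun n => b n ^+ r * v k n) @ \oo -->
                  comb_moment (v k) c,
                energy c <= Eb & energy c = Eb -> b = comb c].
Proof.
move=> cb.
pose A k := limn (series (fun n => b n ^+ r * v k n)).
have cA k : series (fun n => b n ^+ r * v k n) @ \oo --> A k.
  by apply: cvgn_series_young => //; [exact: cvgP cb | exact: cvgn_seriesX].
pose lin c := \sum_k c 0 k * A k.
have clin c : series (fun n => b n ^+ r * comb c n) @ \oo --> lin c.
  have H k : series (fun n => c 0 k * (b n ^+ r * v k n)) @ \oo --> c 0 k * A k.
    exact: cvg_seriesZ.
  apply: eq_cvg_series (cvg_series_sum H) => n.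
  rewrite [X in _ * X]/comb big_distrr/=.
  by apply: eq_bigr => k _; rewrite mulrCA.
pose G c := energy c - r.+1%:R * lin c.
have Gc : continuous G.
  move=> c; apply: continuousB; first exact: energy_continuous.
  apply: continuousM; first exact: cst_continuous.
  apply: continuous_sum_fun => k {}c.
  by apply: continuousM; [exact: coord_continuous | exact: cst_continuous].
have G0 : G 0 = 0.
  rewrite /G /lin (_ : energy 0 = 0) ?big1 ?mulr0 ?subr0// => [k _|].
    by rewrite mxE mul0r.
  by rewrite -(scale0r 0) energyZ expr0n/= mul0r.
(* Young's inequality for [2 b] and [w / 2 ^ r], so that only a fraction of the
   energy is absorbed. *)
have Gge c : energy c / 2 - r%:R * (2 ^+ r.+1 * Eb) <= G c.
  have s2 : (2 ^+ r : R) != 0 by rewrite expf_neq0.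
  have c2b : series (fun n => (2 * b n) ^+ r.+1) @ \oo --> 2 ^+ r.+1 * Eb.
    by apply: eq_cvg_series (cvg_seriesZ cb) => n; rewrite exprMn.
  have cw := @cvg_energy ((2 ^+ r)^-1 *: c).
  have cX : series (fun n => (2 * b n) ^+ r * comb ((2 ^+ r)^-1 *: c) n) @ \oo
      --> lin c.
    apply: eq_cvg_series (@clin c) => n.
    by rewrite combZ exprMn; field.
  have [le _] := young_series r_odd c2b cw cX.
  rewrite /G; rewrite energyZ in le.
  have : ((2 ^+ r)^-1) ^+ r.+1 * energy c <= energy c / 2.
    rewrite mulrC ler_wpM2l ?energy_ge0// exprVn lef_pV2 ?posrE ?exprn_gt0//.
    rewrite -exprM -[leLHS]expr1 ler_eXn2l ?ltr1n//.
    by rewrite muln_gt0 (odd_gt0 r_odd).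
  by lra.
(* By [Gge], this bounds the energy wherever G c <= G 0 = 0. *)
have [B EB] := energy_coercive (2 * (r%:R * (2 ^+ r.+1 * Eb))).
have [c cmin] : exists c, forall c', G c <= G c'.
  apply: (coercive_has_min (B := B)) => // c; rewrite G0 => Gc0.
  by apply: EB; have := Gge c; lra.
(* Young's inequality for w(c') and w(c) bounds energy c' - energy c above by (r + 1) t
   [comb_moment (v k) c'], a gradient inequality that avoids differentiation. Minimality of c bounds
   it below by (r + 1) t [A k]. *)
have first_order t k :
    0 <= t * (comb_moment (v k) (c + t *: delta_mx 0 k) - A k).
  pose c' := c + t *: delta_mx 0 k.
  have cE : series (fun n => comb c' n ^+ r * comb c n) @ \oo -->
      energy c' - t * comb_moment (v k) c'.
    apply: eq_cvg_series (cvg_seriesB (@cvg_energy c')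
      (cvg_seriesZ (k := t) (@cvg_comb_moment (v k) c' (@summable_v k)))) => n.
    by rewrite [in RHS](_ : comb c n = comb c' n - t * v k n);
      [rewrite exprSr; ring | rewrite combD combZ comb_delta addrK].
  have [le _] := young_series r_odd (@cvg_energy c') (@cvg_energy c) cE.
  have linE : lin c' = lin c + t * A k.
    apply: (cvg_series_unique (@clin c')).
    apply: eq_cvg_series (cvg_seriesD (@clin c) (cvg_seriesZ (k := t) (cA k))) => n.
    by rewrite combD combZ comb_delta; ring.
  have := cmin c'; rewrite /G linE -/c'.
  move: le; rewrite -natr1 => le H.
  have : 0 <= r.+1%:R * (t * (comb_moment (v k) c' - A k)).
    by rewrite -natr1 in H *; nra.
  by rewrite pmulr_rge0.
(* The sign of t decides the direction of the inequality in [first_order]; letting t tend to 0 from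
   the left and from the right gives both bounds. *)
have AE k : comb_moment (v k) c = A k.
  pose h t := comb_moment (v k) (c + t *: delta_mx 0 k).
  have hc : h t @[t --> 0] --> comb_moment (v k) c.
    have h0 : h 0 = comb_moment (v k) c by rewrite /h scale0r addr0.
    rewrite -h0; pose line (t : R) : 'rV[R]_N := c + t *: delta_mx 0 k.
    have linec : continuous line.
      move=> t; apply: (@cvgD _ _ _ _ _ (fun=> c) (fun t => t *: delta_mx 0 k)).
        exact: cvg_cst.
      exact: scalel_continuous.
    exact: (continuous_comp (linec 0) (@comb_moment_continuous (v k) (line 0))).
  apply/eqP; rewrite eq_le; apply/andP; split.
    apply: (cvgr_to_le (cvg_at_left_filter hc)); near=> t.
    rewrite -subr_le0 -(@nmulr_rge0 _ t); first exact: first_order.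
    by near: t; exact: nbhs_left_lt.
  apply: (cvgr_to_ge (cvg_at_right_filter hc)); near=> t.
  rewrite -subr_ge0 -(@pmulr_rge0 _ t); first exact: first_order.
  by near: t; exact: nbhs_right_gt.
exists c.
have cM k : series (fun n => b n ^+ r * v k n) @ \oo --> comb_moment (v k) c.
  by rewrite AE; exact: cA.
have cX : series (fun n => b n ^+ r * comb c n) @ \oo --> energy c.
  by rewrite /energy; under eq_bigr do rewrite AE; exact: clin.
(* The pairing of b^r with w(c) is the energy of c itself, so Young's inequality reads (r + 1)
   energy c <= r Eb + energy c. *)
have [le eq] := young_series r_odd cb (@cvg_energy c) cX.
have r0 : (0 : R) < r%:R by rewrite ltr0n odd_gt0.
split=> //.
  by rewrite -(ler_pM2l r0); move: le; rewrite -natr1; lra.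
by move=> e; apply: eq; rewrite -e -natr1; ring.
Unshelve. all: by end_near. Qed.

End combinations.

(** * Convex functions and real powers *)

Section convex_real.
Context {R : realType}.

Lemma convex_functionP (D : set R) (g : R -> R) (a b t : R) :
  convex_function (D : set (convex_lmodType R^o)) g -> D a -> D b ->
  0 <= t -> t <= 1 -> g (t * a + (1 - t) * b) <= t * g a + (1 - t) * g b.
Proof.
move=> gc Da Db t0 t1.
by have := gc (Itv01 t0 t1) _ _ (mem_set Da) (mem_set Db); rewrite !convRE.
Qed.

(** A finite convex function on the line is Lipschitz near x: the chords to x + 1 and x - 1 bound
    its increments above, and a midpoint argument bounds them below. *)
Lemma convex_continuous (g : R -> R) :
  (forall a b t, 0 <= t -> t <= 1 ->
    g (t * a + (1 - t) * b) <= t * g a + (1 - t) * g b) -> continuous g.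
Proof.
(* The final + 1 keeps K positive, so that e / K is available at the end. *)
move=> gc x; pose K := `|g (x + 1) - g x| + `|g (x - 1) - g x| + 1.
have K0 : 0 < K by rewrite ltr_wpDl// addr_ge0.
have up h : `|h| <= 1 -> g (x + h) - g x <= K * `|h|.
  move=> h1; have [h0|/ltW h0] := leP 0 h.
    rewrite ger0_norm// in h1 *.
    have := gc (x + 1) x h h0 h1.
    rewrite (_ : h * (x + 1) + (1 - h) * x = x + h); last by ring.
    have := ler_norm (g (x + 1) - g x); have := normr_ge0 (g (x - 1) - g x).
    by rewrite /K; nra.
  rewrite ler0_norm// in h1 *; rewrite -oppr_ge0 in h0.
  have := gc (x - 1) x (- h) h0 h1.
  rewrite (_ : - h * (x - 1) + (1 - - h) * x = x + h); last by ring.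
  have := ler_norm (g (x - 1) - g x); have := normr_ge0 (g (x + 1) - g x).
  by rewrite /K; nra.
have lip h : `|h| <= 1 -> `|g x - g (x + h)| <= K * `|h|.
  move=> h1; rewrite distrC ler_norml up// andbT.
  (* Since x is the midpoint of x + h and x - h, the upper bound at - h becomes a lower bound at
     h. *)
  have mid : g x <= 2^-1 * g (x + h) + (1 - 2^-1) * g (x - h).
    rewrite -[in leLHS](_ : 2^-1 * (x + h) + (1 - 2^-1) * (x - h) = x); last by field.
    by apply: gc; [rewrite invr_ge0 | rewrite invf_le1// ler1n].
  by have := up (- h); rewrite normrN => /(_ h1); lra.
have nb e : 0 < e -> \forall y \near x, `|x - y| <= e.
  exact: ((cvgrPdist_le id x).1 (@cvg_id _ (nbhs x)) e).
apply/cvgrPdist_le => e e0; near=> y.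
rewrite -(subrKC x y); apply: le_trans (lip _ _) _.
  by rewrite distrC; near: y; apply: nb.
rewrite mulrC -ler_pdivlMr// distrC; near: y.
by apply: nb; rewrite divr_gt0.
Unshelve. all: by end_near. Qed.

(** For uniqueness: l, l', lm are the losses and t, t', tm the norms of two minimizers and their
    midpoint. Either t <> t' or tm < t would put the midpoint's risk strictly below the average of
    the other two. *)
Lemma strictly_convex_midpoint (g : R -> R) (l l' lm t t' tm : R) :
  strictly_convex_on_nonneg g ->
  (forall a b, 0 <= a -> a < b -> g a < g b) ->
  0 <= t -> 0 <= t' -> 0 <= tm -> tm <= 2^-1 * t + 2^-1 * t' ->
  lm <= 2^-1 * l + 2^-1 * l' ->
  l + g t <= lm + g tm -> l' + g t' <= lm + g tm -> t = t' /\ tm = t.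
Proof.
move=> g_strict g_lt t0 t0' tm0 tm_le lm_le H H'.
have [e|ne] := eqVneq t t'.
  split=> //; apply/eqP; rewrite eq_le; apply/andP; split; first by lra.
  by rewrite leNgt; apply/negP => /(g_lt _ _ tm0); rewrite -e in H' *; lra.
have g_mid : g tm <= g (2^-1 * t + 2^-1 * t').
  by move: tm_le; rewrite le_eqVlt => /predU1P[->//|/(g_lt _ _ tm0)/ltW].
have h0 : 0 < 2^-1 :> R by rewrite invr_gt0.
have h1 : 2^-1 < 1 :> R by rewrite invf_lt1// ltr1n.
have := g_strict _ _ _ t0 t0' ne h0 h1.
by rewrite (_ : 1 - 2^-1 = 2^-1) => [|]; [lra | field].
Qed.

Lemma powRVK (a z : R) : 0 < a -> 0 <= z -> (z `^ a^-1) `^ a = z.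
Proof. by move=> a0 z0; rewrite -powRrM mulVf ?gt_eqF// powRr1. Qed.

Lemma powR_comp_continuous (T : topologicalType) (f : T -> R) (a : R) : 0 < a ->
  (forall x, 0 <= f x) -> continuous f -> continuous (fun x => f x `^ a).
Proof.
(* The formula through [expR] and [ln] works only where f x > 0; at a zero of f, the bound f y <=
   e^(1/a) is used instead. *)
move=> a0 f0 fc x; have := f0 x; rewrite le_eqVlt => /orP[/eqP fx0|fx].
  rewrite /continuous_at -fx0 powR0 ?gt_eqF//; apply/cvgrPdist_le => e e0; near=> y.
  rewrite sub0r normrN ger0_norm ?powR_ge0//.
  rewrite -[leRHS](powRr1 (ltW e0)) -(@mulVf _ a) ?gt_eqF// powRrM.
  apply: ge0_ler_powR; rewrite ?nnegrE ?powR_ge0 ?(ltW a0)//.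
  have : `|f x - f y| <= e `^ a^-1.
    by near: y; move/cvgrPdist_le : (fc x); apply; exact: powR_gt0.
  by rewrite -fx0 sub0r normrN ger0_norm.
have h : (fun y => expR (a * ln (f y))) y @[y --> x] --> f x `^ a.
  rewrite /powR gt_eqF//; apply: continuous_comp; last exact: continuous_expR.
  apply: continuousM; first exact: cst_continuous.
  by apply: continuous_comp; [exact: fc | exact: continuous_ln].
apply: cvg_trans h; apply: near_eq_cvg; near=> y.
have fy : 0 < f y by near: y; apply: (cvgr_gt (f x)) => //; exact: fc.
by rewrite /powR gt_eqF.
Unshelve. all: by end_near. Qed.

End convex_real.

(** * Sequences of l_p as odd powers *)

Section lp_odd_root.
Context {R : realType}.
Implicit Types (a b : nat -> R).

Lemma lp_norm_cvg p a E : 0 < p ->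
  series (fun n => `|a n| `^ p) @ \oo --> E -> lp_norm p a = (E `^ p^-1)%:E.
Proof.
move=> p0 aE; rewrite /lp_norm Lnorm_counting//.
rewrite (_ : (\sum_(k <oo) _)%E = E%:E) ?poweR_EFin//.
rewrite -(cvg_lim _ aE)// -EFin_lim; last exact: cvgP aE.
apply: congr_lim; apply/funext => n /=.
by rewrite /series/= -sumEFin; apply: eq_bigr => k _; rewrite -poweR_EFin.
Qed.

Lemma lp_cvg p a : 0 < p -> lp p a -> cvgn (series (fun n => `|a n| `^ p)).
Proof.
move=> p0; rewrite /lp/= /lp_norm Lnorm_counting// => aoo.
apply: nnseries_is_cvg => [n|]; first exact: powR_ge0.
rewrite ltey; apply/eqP => e.
move: aoo; rewrite (eq_eseriesr (g := fun n => (`|a n| `^ p)%:E)); last first.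
  by move=> n _; rewrite -poweR_EFin.
by rewrite e poweRyr ?ltxx// invr_eq0 gt_eqF.
Qed.

Lemma lp_normZ p k a : 0 < p -> lp p a ->
  lp_norm p (fun n => k * a n) = (`|k|%:E * lp_norm p a)%E.
Proof.
move=> p0 lpa; have aE := lp_cvg p0 lpa.
rewrite (lp_norm_cvg p0 aE).
have kE : series (fun n => `|k * a n| `^ p) @ \oo -->
    `|k| `^ p * limn (series (fun n => `|a n| `^ p)).
  apply: eq_cvg_series (cvg_seriesZ aE) => n.
  by rewrite normrM powRM.
rewrite (lp_norm_cvg p0 kE) -EFinM powRM ?powR_ge0//; last first.
  by apply: le_trans (cvg_series_ge0 _ aE 0%N) => // n; exact: powR_ge0.
by rewrite -powRrM mulfV ?gt_eqF// powRr1.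
Qed.

Lemma lp_normD (p : R) a a' : 1 <= p ->
  (lp_norm p (fun n => a n + a' n)%R <= lp_norm p a + lp_norm p a')%E.
Proof. by move=> p1; exact: minkowski_EFin. Qed.

Lemma odd_root r (x : R) : odd r -> exists y, y ^+ r = x.
Proof.
move=> ro; exists (Num.sg x * `|x| `^ r%:R^-1).
have r0 : (r%:R : R) != 0 by rewrite pnatr_eq0 -lt0n odd_gt0.
rewrite exprMn -(powR_mulrn r (powR_ge0 _ _)) -powRrM mulVf// powRr1//.
have [->|x0] := eqVneq x 0; first by rewrite normr0 mulr0.
by rewrite sgr_odd// ro expr1 -numEsg.
Qed.

Variable r : nat.
Hypothesis r_odd : odd r.
Let p : R := r.+1%:R / r%:R.

(** Since p r = r + 1 is even, the p-norm of b^r is expressed by integer powers of b without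
    absolute values. *)
Lemma powR_norm_odd (x : R) : `|x ^+ r| `^ p = x ^+ r.+1.
Proof.
have r0 : (r%:R : R) != 0 by rewrite pnatr_eq0 -lt0n odd_gt0.
rewrite normrX -(powR_mulrn r (normr_ge0 x)) -powRrM /p mulrC mulfVK// powR_mulrn//.
exact: norm_exprS_odd.
Qed.

Lemma lp_norm_odd_root b E : series (fun n => b n ^+ r.+1) @ \oo --> E ->
  lp_norm p (fun n => b n ^+ r) = (E `^ p^-1)%:E.
Proof.
move=> bE; apply: lp_norm_cvg; first by rewrite divr_gt0// ltr0n ?odd_gt0.
by apply: eq_cvg_series bE => n; rewrite powR_norm_odd.
Qed.

Lemma lp_odd_root_ex a : lp p a -> exists b,
  a = (fun n => b n ^+ r) /\ cvgn (series (fun n => b n ^+ r.+1)).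
Proof.
move=> lpa; have /choice[b ba] : forall n, exists y, y ^+ r = a n.
  by move=> n; exact: odd_root.
exists b; split; first exact/funext.
rewrite (_ : (fun n => _) = (fun n => `|a n| `^ p)); last first.
  by apply/funext => n; rewrite -ba powR_norm_odd.
by apply: lp_cvg => //; rewrite divr_gt0// ltr0n ?odd_gt0.
Qed.

(* [d ^+ r * d] splits linearly into [a ^+ r * d] and [b ^+ r * d], to which Young's
   inequality applies. *)
Lemma energy_midpoint a b d (Ea Eb Ed : R) :
  series (fun n => a n ^+ r.+1) @ \oo --> Ea ->
  series (fun n => b n ^+ r.+1) @ \oo --> Eb ->
  series (fun n => d n ^+ r.+1) @ \oo --> Ed ->
  (forall n, d n ^+ r = 2^-1 * a n ^+ r + 2^-1 * b n ^+ r) ->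
  2 * Ed <= Ea + Eb /\ (2 * Ed = Ea + Eb -> a = b).
Proof.
move=> cA cB cD dE.
have cX := cvgn_series_young r_odd (cvgP _ cA) (cvgP _ cD).
have cY := cvgn_series_young r_odd (cvgP _ cB) (cvgP _ cD).
have XY : Ed = 2^-1 * limn (series (fun n => a n ^+ r * d n)) +
               2^-1 * limn (series (fun n => b n ^+ r * d n)).
  apply: (cvg_series_unique cD).
  apply: eq_cvg_series (cvg_seriesD (cvg_seriesZ (k := 2^-1) cX)
                                   (cvg_seriesZ (k := 2^-1) cY)) => n.
  by rewrite exprSr dE; ring.
have [leX eqX] := young_series r_odd cA cD cX.
have [leY eqY] := young_series r_odd cB cD cY.
move: leX eqX leY eqY XY; move: (limn _) (limn _) => X Y leX eqX leY eqY XY.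
have r0 : (0 : R) < r%:R by rewrite ltr0n odd_gt0.
move: leX eqX leY eqY; rewrite -natr1 => leX eqX leY eqY.
have rXY : r%:R * Ed = r%:R * X / 2 + r%:R * Y / 2 by rewrite XY; ring.
split.
  by rewrite -(ler_pM2l r0); lra.
(* Equality of the sums makes both Young inequalities tight, so a and b both equal d. *)
move=> e; have re : r%:R * (2 * Ed) = r%:R * (Ea + Eb) by rewrite e.
by rewrite eqX ?eqY//; lra.
Qed.

End lp_odd_root.

(** * Representer theorem, existence and uniqueness of solutions *)

Section svm.
Context {R : realType} {T : Type} (phi : nat -> T -> R).
Hypothesis summable_phi : forall u, cvgn (series (fun n => `|phi n u|)).
Variable r : nat.
Hypothesis r_odd : odd r.
Let p : R := r.+1%:R / r%:R.
Hypothesis norm_BK : BK_norm_well_defined phi p.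

Let p_gt0 : 0 < p.
Proof. by rewrite divr_gt0// ltr0n ?odd_gt0. Qed.

Let p_ge1 : 1 <= p.
Proof. by rewrite ler_pdivlMr ?ltr0n ?odd_gt0// mul1r ler_nat. Qed.

Lemma BK_norm_expansion a f : lp p a -> expansion phi a f ->
  (BK_norm phi p f)%:E = lp_norm p a.
Proof.
move=> lpa af; pose P := [set a | lp p a /\ expansion phi a f].
have [lpg gf] : P (get P) by apply: getPex; exists a.
rewrite /BK_norm (norm_BK lpg lpa gf af) fineK// ge0_fin_numE//.
by rewrite /lp_norm Lnorm_ge0.
Qed.

Lemma BK_norm_ge0 f : 0 <= BK_norm phi p f.
Proof. by rewrite fine_ge0// /lp_norm Lnorm_ge0. Qed.

Lemma BK_norm_odd_root b (E : R) f :
  series (fun n => b n ^+ r.+1) @ \oo --> E ->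
  expansion phi (fun n => b n ^+ r) f -> BK phi p f /\ BK_norm phi p f = E `^ p^-1.
Proof.
move=> bE bf; have bN := lp_norm_odd_root r_odd bE.
have lpb : lp p (fun n => b n ^+ r) by rewrite /lp/= bN ltry.
split; first by exists (fun n => b n ^+ r).
by have := BK_norm_expansion lpb bf; rewrite bN => -[].
Qed.

Lemma BK_odd_root f : BK phi p f -> exists b (E : R),
  [/\ series (fun n => b n ^+ r.+1) @ \oo --> E,
      expansion phi (fun n => b n ^+ r) f & BK_norm phi p f = E `^ p^-1].
Proof.
move=> [a lpa af]; have [b [ab cb]] := lp_odd_root_ex r_odd lpa.
rewrite ab in af; exists b, (limn (series (fun n => b n ^+ r.+1))).
by split=> //; have [] := BK_norm_odd_root cb af.
Qed.

Context {N : nat} (x : 'I_N -> T).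
Implicit Types (c : 'rV[R]_N).

Let v k n := phi n (x k).
Let summable_v k : cvgn (series (fun n => `|v k n|)).
Proof. exact: summable_phi. Qed.

Hypothesis free_v : forall c, (forall n, comb v c n = 0) -> c = 0.

(** The function with coefficients w(c)^r, defined directly by its finite kernel expansion. *)
Definition comb_fun c u := comb_moment v r (fun n => phi n u) c.

Lemma comb_fun_BK c : BK phi p (comb_fun c) /\
  BK_norm phi p (comb_fun c) = energy v r c `^ p^-1.
Proof.
apply: (BK_norm_odd_root (b := comb v c)); first exact: cvg_energy.
by move=> u; exact: cvg_comb_moment.
Qed.

(** For the odd root b of the coefficients of f, the moments of b^r against v k are the values f (x
    k), so [comb_moment_match] yields interpolation; raising energies to the power 1/p turns their
    comparison into one of norms. *)
Lemma representer f : BK phi p f -> exists c,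
  [/\ forall k, comb_fun c (x k) = f (x k),
      BK_norm phi p (comb_fun c) <= BK_norm phi p f &
      BK_norm phi p (comb_fun c) = BK_norm phi p f -> f = comb_fun c].
Proof.
move=> /BK_odd_root[b [E [bE bf fE]]].
have [c [cM le eq]] := comb_moment_match summable_v r_odd free_v bE.
have E0 := cvg_series_exprS_ge0 r_odd bE.
have [_ cE] := comb_fun_BK c.
exists c; split.
- by move=> k; apply: cvg_series_unique (cM k) (bf (x k)).
- by rewrite cE fE ge0_ler_powR ?nnegrE ?energy_ge0 ?invr_ge0 ?(ltW p_gt0).
- rewrite cE fE => e; apply/funext => u; apply: cvg_series_unique (bf u) _.
  rewrite eq; first exact: cvg_comb_moment.
  by rewrite -(powRVK p_gt0 (energy_ge0 summable_v r_odd c)) e powRVK.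
Qed.

Variables (y : 'I_N -> R) (L : T -> R -> R -> R) (Rg : R -> R).
Hypothesis Rg_ge0 : forall r, 0 <= r -> 0 <= Rg r.
Hypothesis Rg_convex : convex_function (`[0, +oo[%classic : set R) Rg.
Hypothesis Rg_incr : {in `[0, +oo[ &, {homo Rg : r s / r < s}}.
Hypothesis L_ge0 : forall u v t, 0 <= L u v t.
Hypothesis L_convex : forall u v, convex_function ([set: R] : set R) (L u v).

Let Rg_lt s t : 0 <= s -> s < t -> Rg s < Rg t.
Proof.
move=> s0 st; apply: Rg_incr => //; rewrite in_itv/= andbT//.
exact: le_trans s0 (ltW st).
Qed.

Let Rg_le s t : 0 <= s -> s <= t -> Rg s <= Rg t.
Proof. by move=> s0; rewrite le_eqVlt => /predU1P[->//|/(Rg_lt s0)/ltW]. Qed.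

Let Rg_conv s t l : 0 <= s -> 0 <= t -> 0 <= l -> l <= 1 ->
  Rg (l * s + (1 - l) * t) <= l * Rg s + (1 - l) * Rg t.
Proof.
by move=> s0 t0; apply: (convex_functionP Rg_convex); rewrite /= in_itv/= andbT.
Qed.

Let L_conv u w s t l : 0 <= l -> l <= 1 ->
  L u w (l * s + (1 - l) * t) <= l * L u w s + (1 - l) * L u w t.
Proof. exact: (convex_functionP (@L_convex u w)). Qed.

(** [Rg] is convex on [0, +oo[ only; being increasing there, it has a convex even extension to the
    whole line, to which [convex_continuous] applies. *)
Let Rg_norm_continuous : continuous (fun t : R => Rg `|t|).
Proof.
apply: convex_continuous => a b t t0 t1.
have t1' : 0 <= 1 - t by rewrite subr_ge0.
apply: le_trans (Rg_conv (normr_ge0 a) (normr_ge0 b) t0 t1).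
apply: Rg_le => //; apply: le_trans (ler_normD _ _) _.
by rewrite !normrM (ger0_norm t0) (ger0_norm t1').
Qed.

Let L_continuous u w : continuous (L u w).
Proof. by apply: convex_continuous => a b t; exact: L_conv. Qed.

Let risk := svm_risk phi p x y L Rg.

Let loss_ge0 f : 0 <= N%:R^-1 * \sum_(k < N) L (x k) (y k) (f (x k)).
Proof. by rewrite mulr_ge0// ?invr_ge0// sumr_ge0. Qed.

Lemma comb_risk_continuous : continuous (fun c => risk (comb_fun c)).
Proof.
pose loss c := N%:R^-1 * (\sum_(k < N) L (x k) (y k) (comb_fun c (x k))).
pose reg c := Rg `|energy v r c `^ p^-1|.
have -> : (fun c => risk (comb_fun c)) = (fun c => loss c + reg c).
  apply/funext => c; rewrite /risk /svm_risk; have [_ ->] := comb_fun_BK c.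
  by rewrite /reg (ger0_norm (powR_ge0 _ _)).
have loss_c : continuous loss.
  move=> c; apply: (@continuousM R _ (fun=> N%:R^-1)
    (fun c => \sum_(k < N) L (x k) (y k) (comb_fun c (x k)))).
    exact: cst_continuous.
  apply: (continuous_sum_fun
    (F := fun k c => L (x k) (y k) (comb_fun c (x k)))) => k {}c.
  apply: (continuous_comp (g := L (x k) (y k))); last exact: L_continuous.
  exact: comb_moment_continuous.
have reg_c : continuous reg.
  move=> c.
  apply: (@continuous_comp _ _ _ (fun c => energy v r c `^ p^-1)
    (fun t : R => Rg `|t|)); last exact: Rg_norm_continuous.
  apply: powR_comp_continuous; [by rewrite invr_gt0|exact: energy_ge0|].
  exact: energy_continuous.
by move=> c; apply: continuousD; [exact: loss_c | exact: reg_c].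
Qed.

Lemma comb_risk_coercive M :
  exists B, forall c, risk (comb_fun c) <= M -> `|c| <= B.
Proof.
have R01 : 0 < Rg 1 - Rg 0 by rewrite subr_gt0 Rg_lt.
(* Convexity between 0 and t > 1 gives t (Rg 1 - Rg 0) <= Rg t - Rg 0, so Rg t <= M forces t <=
   t0. *)
pose t0 := Num.max 1 (M / (Rg 1 - Rg 0)).
have [B EB] := energy_coercive summable_v r_odd free_v (t0 `^ p).
exists B => c cM; apply: EB.
have : Rg (energy v r c `^ p^-1) <= M.
  apply: le_trans cM; rewrite /risk /svm_risk; have [_ ->] := comb_fun_BK c.
  by rewrite lerDr; exact: loss_ge0.
set t := _ `^ p^-1 => RgM.
have -> : energy v r c = t `^ p.
  by rewrite powRVK// energy_ge0.
have tge0 : 0 <= t by exact: powR_ge0.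
apply: ge0_ler_powR; rewrite ?nnegrE ?(ltW p_gt0)//.
  by rewrite /t0 le_max ler01.
rewrite /t0 le_max; have [//|t1/=] := leP t 1.
rewrite ler_pdivlMr//.
have t_gt0 : 0 < t by exact: lt_trans t1.
have tv0 : 0 <= t^-1 by rewrite invr_ge0.
have tv1 : t^-1 <= 1 by rewrite invf_le1// ltW.
have := Rg_conv tge0 (lexx 0) tv0 tv1.
rewrite mulr0 addr0 mulVf ?gt_eqF// => H.
have : t * Rg 1 <= t * (t^-1 * Rg t + (1 - t^-1) * Rg 0) by rewrite ler_pM2l.
have -> : t * (t^-1 * Rg t + (1 - t^-1) * Rg 0) = Rg t + (t - 1) * Rg 0.
  by field; rewrite gt_eqF.
by have := Rg_ge0 (lexx 0); lra.
Qed.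

Lemma svm_solution_ex : exists s, svm_solution phi p x y L Rg s.
Proof.
have [B cB] := comb_risk_coercive (risk (comb_fun 0)).
have [c cmin] := coercive_has_min comb_risk_continuous cB.
exists (comb_fun c); split=> [|g /representer[c' [gE gle _]]].
  by have [] := comb_fun_BK c.
apply: le_trans (cmin c') _; rewrite /risk /svm_risk lerD//.
  by under eq_bigr do rewrite gE.
by apply: Rg_le => //; exact: BK_norm_ge0.
Qed.

(** The representer has the same loss as s, so a strictly smaller norm would contradict minimality;
    equal norms identify the two functions. *)
Lemma svm_solution_comb s : svm_solution phi p x y L Rg s ->
  exists c, s = comb_fun c.
Proof.
move=> [BKs smin]; have [c [cs cle eq]] := representer BKs; exists c; apply: eq.
apply/eqP; rewrite eq_le cle leNgt/=; apply/negP => /(Rg_lt (BK_norm_ge0 _)) lt.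
have [BKc _] := comb_fun_BK c; have := smin _ BKc.
rewrite /svm_risk; under [in leRHS]eq_bigr do rewrite cs.
by rewrite lerD2l leNgt lt.
Qed.

(** Strict convexity of [Rg] gives s, s' and their midpoint f the same norm; strict convexity of the
    p-norm, in the form of [energy_midpoint], then identifies the coefficients. *)
Lemma svm_solution_unique s s' : strictly_convex_on_nonneg Rg ->
  svm_solution phi p x y L Rg s -> svm_solution phi p x y L Rg s' -> s = s'.
Proof.
move=> Rg_strict [BKs smin] [BKs' s'min].
have [b [E [bE bs sE]]] := BK_odd_root BKs.
have [b' [E' [bE' bs' sE']]] := BK_odd_root BKs'.
have E0 := cvg_series_exprS_ge0 r_odd bE; have E0' := cvg_series_exprS_ge0 r_odd bE'.
have half : `|2^-1| = 2^-1 :> R by rewrite ger0_norm.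
pose a n := 2^-1 * b n ^+ r + 2^-1 * b' n ^+ r.
have [f fE] : exists f, forall u, f u = 2^-1 * s u + 2^-1 * s' u.
  by exists (fun u => 2^-1 * s u + 2^-1 * s' u).
have af : expansion phi a f.
  move=> u; rewrite fE.
  apply: eq_cvg_series (cvg_seriesD (cvg_seriesZ (k := 2^-1) (bs u))
                                (cvg_seriesZ (k := 2^-1) (bs' u))) => n.
  by rewrite /a; ring.
have aN : (lp_norm p a <= (2^-1 * E `^ p^-1 + 2^-1 * E' `^ p^-1)%:E)%E.
  apply: le_trans (lp_normD _ _ p_ge1) _.
  have lpb : lp p (fun n => b n ^+ r).
    by rewrite /lp/= (lp_norm_odd_root r_odd bE) ltry.
  have lpb' : lp p (fun n => b' n ^+ r).
    by rewrite /lp/= (lp_norm_odd_root r_odd bE') ltry.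
  rewrite (lp_normZ _ p_gt0 lpb) (lp_normZ _ p_gt0 lpb') half.
  by rewrite (lp_norm_odd_root r_odd bE) (lp_norm_odd_root r_odd bE').
have lpa : lp p a by apply: le_lt_trans aN _; rewrite ltry.
have BKf : BK phi p f by exists a.
have fN := BK_norm_expansion lpa af.
rewrite -fN lee_fin -sE -sE' in aN.
have loss : N%:R^-1 * (\sum_(k < N) L (x k) (y k) (f (x k))) <=
   2^-1 * (N%:R^-1 * (\sum_(k < N) L (x k) (y k) (s (x k)))) +
   2^-1 * (N%:R^-1 * (\sum_(k < N) L (x k) (y k) (s' (x k)))).
  rewrite ![2^-1 * (N%:R^-1 * _)]mulrCA -mulrDr ler_wpM2l ?invr_ge0//.
  rewrite !big_distrr/= -big_split/=; apply: ler_sum => k _.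
  rewrite fE; have := @L_conv (x k) (y k) (s (x k)) (s' (x k)) 2^-1.
  rewrite (_ : 1 - 2^-1 = 2^-1); last by field.
  by apply; rewrite ?invr_ge0// invf_le1// ler1n.
have [e tm] := strictly_convex_midpoint Rg_strict Rg_lt (BK_norm_ge0 s)
  (BK_norm_ge0 s') (BK_norm_ge0 f) aN loss (smin _ BKf) (s'min _ BKf).
have [d' [ad cd]] := lp_odd_root_ex r_odd lpa.
have af' : expansion phi (fun n => d' n ^+ r) f by rewrite -ad.
have [_ fN'] := BK_norm_odd_root cd af'.
(* Raising to the power p turns equal norms into equal energies, which is the equality case of
   [energy_midpoint]. *)
have EE' : E = E' by rewrite -(powRVK p_gt0 E0) -sE e sE' powRVK.
have EmE : limn (series (fun n => d' n ^+ r.+1)) = E.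
  rewrite -[LHS](powRVK p_gt0); last exact: (cvg_series_exprS_ge0 r_odd cd).
  by rewrite -fN' tm sE powRVK.
have [_ bb'] := energy_midpoint r_odd bE bE' cd
  (fun n => esym (congr1 (@^~ n) ad)).
have {}bb' : b = b' by apply: bb'; rewrite EmE -EE'; ring.
by apply/funext => u; apply: cvg_series_unique (bs u) _; rewrite bb'; exact: bs'.
Qed.

End svm.

Theorem theorem5p10 (R : realType) (Omega Omega' : ptopologicalType)
    (hausdorff_Omega : hausdorff_space Omega)
    (hausdorff_Omega' : hausdorff_space Omega')
    (lc_Omega : locally_compact [set: Omega])
    (lc_Omega' : locally_compact [set: Omega'])
    (mu : {measure set (borelType Omega) -> \bar R})
    (mu' : {measure set (borelType Omega') -> \bar R})
    (regular_mu : regular_borel_measure mu)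
    (regular_mu' : regular_borel_measure mu')
    (m : nat) (m_gt0 : (0 < m)%N)
    (p : R) (p_def : p = (2 * m)%:R / ((2 * m)%:R - 1))
    (K : Omega * Omega' -> R)
    (phi : nat -> Omega -> R) (phi' : nat -> Omega' -> R)
    (mercer_K : generalized_mercer_kernel K phi phi')
    (free_phi : linearly_independent phi)
    (free_phi' : linearly_independent phi')
    (summable_phi : forall x, cvgn (series (fun n => `|phi n x|)))
    (summable_phi' : forall y, cvgn (series (fun n => `|phi' n y|)))
    (free_K : linearly_independent (fun (x : Omega) (y : Omega') => K (x, y)))
    (norm_BK : BK_norm_well_defined phi p)
    (N : nat) (N_gt0 : (0 < N)%N)
    (x : 'I_N -> Omega) (x_inj : injective x) (y : 'I_N -> R)
    (Rg : R -> R)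
    (Rg_ge0 : forall r, 0 <= r -> 0 <= Rg r)
    (Rg_convex : convex_function (`[0, +oo[%classic : set R) Rg)
    (Rg_incr : {in `[0, +oo[ &, {homo Rg : r s / r < s}})
    (L : Omega -> R -> R -> R)
    (L_ge0 : forall u v t, 0 <= L u v t)
    (L_convex : forall u v, convex_function ([set: R] : set R) (L u v)) :
  [/\ exists s, svm_solution phi p x y L Rg s,
      strictly_convex_on_nonneg Rg ->
        forall s s', svm_solution phi p x y L Rg s ->
          svm_solution phi p x y L Rg s' -> s = s'
    & forall s, svm_solution phi p x y L Rg s ->
        exists c : 'I_N -> R,
          (forall u, s u =
             \sum_(k : {ffun 'I_(2 * m).-1 -> 'I_N})
               (\prod_(j < (2 * m).-1) c (k j)) * Kstar phi u (x \o k)) /\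
          BK_norm phi p s =
            (\sum_(k0 < N) \sum_(k : {ffun 'I_(2 * m).-1 -> 'I_N})
               (c k0 * \prod_(j < (2 * m).-1) c (k j)) *
               Kstar phi (x k0) (x \o k)) `^ (1 - (2 * m)%:R^-1)].
Proof.
pose r := (2 * m).-1.
have r_odd : odd r 
  by rewrite /r mul2n; case: (m) m_gt0 => // k _; rewrite doubleS/= odd_double.
have rS : (2 * m)%N = r.+1 by rewrite /r prednK// muln_gt0.
have pE : p = r.+1%:R / r%:R by rewrite p_def rS -natr1 addrK.
(* If w(c) = 0, then sum_k c_k K(x_k, .) = sum_n w(c)_n phi'_n = 0, and independence of the
   right-sided kernels gives c = 0. *)
have free_v (c : 'rV[R]_N) :
    (forall n, comb (fun k n => phi n (x k)) c n = 0) -> c = 0.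
  (* Independence of the kernels takes coefficients indexed by points of [Omega], so c is carried
     along the injective x. *)
  move=> c0; pose c' u := \sum_(k < N | x k == u) c 0 k.
  have c'x k : c' (x k) = c 0 k.
    rewrite /c' (bigD1 k)//= big1 ?addr0// => j /andP[/eqP/x_inj->].
    by rewrite eqxx.
  have Kc w : \sum_(u <- [seq x k | k <- enum 'I_N]) c' u * K (u, w) = 0.
    rewrite big_map big_enum/=; have [_ _ _ cK] := mercer_K.
    have H k : series (fun n => c' (x k) * (phi n (x k) * phi' n w)) @ \oo -->
        c' (x k) * K (x k, w) by exact: cvg_seriesZ.
    apply: (cvg_series_unique (cvg_series_sum H)).
    rewrite (_ : series _ = cst 0); first exact: cvg_cst.
    apply/funext => n; rewrite /series/= big1// => i _.
    rewrite -[RHS](mul0r (phi' i w)) -[in RHS](c0 i) /comb big_distrl/=.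
    by apply: eq_bigr => k _; rewrite c'x mulrA.
  apply/rowP => k; rewrite mxE -c'x.
  apply: (free_K [seq x k | k <- enum 'I_N] c' _ Kc).
    by rewrite map_inj_uniq ?enum_uniq.
  by apply/mapP; exists k; rewrite ?mem_enum.
rewrite pE in norm_BK *; split.
- exact: svm_solution_ex.
- by move=> Rg_strict s s'; exact: svm_solution_unique.
move=> s /(svm_solution_comb summable_phi r_odd norm_BK free_v Rg_incr)[c ->].
exists (fun k => c 0 k); split=> [//|].
have [_ ->] := comb_fun_BK summable_phi r_odd norm_BK x c.
congr (_ `^ _).
  apply: eq_bigr => k0 _; rewrite big_distrr/=.
  by apply: eq_bigr => k _; rewrite mulrA.
(* The exponent is 1/p = r/(r + 1) = 1 - 1/(2m). *)
by rewrite rS invf_div -[r%:R](addrK 1) natr1 mulrBl mulfV ?pnatr_eq0// mul1r.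
Qed.
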